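(* In the coin-tossing game, Reality can strongly comply with the event \[\sum_n p_n<\infty\iff\sum_n x_n<\infty .\]
   Context: Coin-tossing game (players Forecaster, Skeptic, Reality; perfect information): $\mathcal{K}_0:=1$. For $n=1,2,\ldots$: Forecaster announces $p_n\in[0,1]$; then Skeptic announces $M_n\in\mathbb{R}$; then Reality announces $x_n\in\{0,1\}$; then $\mathcal{K}_n:=\mathcal{K}_{n-1}+M_n(x_n-p_n)$. Collateral duty of Skeptic: he must keep $\mathcal{K}_n$ non-negative for all $n$. A path is the infinite sequence $\xi=(p_1,x_1,p_2,x_2,\ldots)$ of moves of Forecaster and Reality; the sample space $\Omega$ is the set of all paths, and an event is any subset $E\subseteq\Omega$. A strategy of Reality is a deterministic rule giving $x_n$ as a function of all moves of all players made before it (including $p_n$ and $M_n$). Reality strongly complies with an event $E$ by a strategy $R$ if, whenever Reality follows $R$, irrespective of the moves of Forecaster and Skeptic (with Skeptic observing his collateral duty), (i) the resulting path $\xi$ belongs to $E$, and (ii) $\mathcal{K}_n\le\mathcal{K}_0$ for all $n$. Reality can strongly comply with $E$ if such a strategy exists. *)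

(* Defs.v *)
From HB Require Import structures.
From mathcomp Require Import all_boot all_order all_algebra.
From mathcomp Require Import all_classical all_reals all_analysis.

Set Implicit Arguments.
Unset Strict Implicit.
Unset Printing Implicit Defensive.

Import Order.TTheory GRing.Theory Num.Theory.

Local Open Scope classical_set_scope.
Local Open Scope ring_scope.

(* Rounds are numbered from 0, so that [p n], [M n], [x n] below are the moves
   $p_{n+1}$, $M_{n+1}$, $x_{n+1}$ of the game whose rounds start at 1.
   Reality's move is a boolean: [true] is 1 and [false] is 0. *)

Section CoinTossing.
Variable R : realType.

Definition game_round : Type := ({i01 R} * R * bool)%type.

(* The arguments are the completed rounds, in chronological order, followed by
   the moves of Forecaster and Skeptic in the current round. *)
Definition reality_strategy : Type := seq game_round -> {i01 R} -> R -> bool.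

Definition game_path : Type := nat -> {i01 R} * bool.

Fixpoint history (S : reality_strategy) (p : nat -> {i01 R}) (M : nat -> R)
    (n : nat) : seq game_round :=
  if n is m.+1 then
    let h := history S p M m in rcons h (p m, M m, S h (p m) (M m))
  else [::].

Definition outcome (S : reality_strategy) (p : nat -> {i01 R}) (M : nat -> R)
    (n : nat) : bool :=
  S (history S p M n) (p n) (M n).

(* Skeptic's capital after [n] rounds. *)
Fixpoint capital (p : nat -> {i01 R}) (M : nat -> R) (x : nat -> bool)
    (n : nat) : R :=
  if n is m.+1 then capital p M x m + M m * ((x m)%:R - (p m)%:num)
  else 1.

(* As the strategy is deterministic, quantifying over all behaviours of
   Forecaster and Skeptic, who may react to anything done before, amounts to
   quantifying over the sequences of moves they make. *)
Definition strongly_complies (E : set game_path) (S : reality_strategy) : Prop :=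
  forall (p : nat -> {i01 R}) (M : nat -> R),
    let x := outcome S p M in
    let K := capital p M x in
    (forall n, 0 <= K n) ->
    E (fun n => (p n, x n)) /\ (forall n, K n <= K 0%N).

Definition can_strongly_comply (E : set game_path) : Prop :=
  exists S : reality_strategy, strongly_complies E S.

End CoinTossing.

(* Main.v *)
Require Import Defs.
From mathcomp Require Import all_boot all_order all_algebra.
From mathcomp Require Import all_classical all_reals all_analysis.
From mathcomp Require Import ring lra.

(** Let [P] and [X] be the sums of the moves of Forecaster and Reality so far.
    If each [x] were 1 with probability [p], then
    [L := 2^X exp(-P) + 2^(-X) exp(P/2)] would be a positive supermartingale; if it stays bounded then [P] and [X] are bounded
    together.  With [D := 1 - K] the loss of Skeptic, Reality moves so that
    [D / L] never decreases; this is possible because [D] is a martingale and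
    [L] a supermartingale.  Hence [D] stays nonnegative.  Once [D > 0], the
    bound [D <= 1] forced by the collateral duty bounds [L].  As long as
    [D = 0], Reality also keeps [L] from increasing. *)

Set Implicit Arguments.
Unset Strict Implicit.
Unset Printing Implicit Defensive.

Import Order.TTheory GRing.Theory Num.Theory.

Local Open Scope classical_set_scope.
Local Open Scope ring_scope.

Lemma nneseries_lty_bounded (R : realType) (u : nat -> R) :
  (forall n, 0 <= u n) ->
  (\sum_(0 <= n <oo) (u n)%:E < +oo)%E <->
  exists B, forall n, \sum_(0 <= i < n) u i <= B.
Proof.
move=> u0; have u0E n : (0 <= n)%N -> true -> (0 <= (u n)%:E)%E.
  by move=> _ _; rewrite lee_fin.
split=> [fin|[B uB]].
  have fin_num : (\sum_(0 <= n <oo) (u n)%:E)%E \is a fin_num.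
    by rewrite ge0_fin_numE //; apply: nneseries_ge0.
  exists (fine (\sum_(0 <= n <oo) (u n)%:E)%E) => n.
  by rewrite -lee_fin fineK // -sumEFin; apply: nneseries_lim_ge.
apply: (@le_lt_trans _ _ B%:E); last exact: ltry.
apply: lime_le; first exact: is_cvg_nneseries.
by apply: nearW => n; rewrite sumEFin lee_fin.
Qed.

Section Potential.
Variable R : realType.
Implicit Types (P p : R) (X : nat).

Definition potential P X : R :=
  2 ^+ X * expR (- P) + 2 ^- X * expR (P / 2).

Lemma potential_gt0 P X : 0 < potential P X.
Proof.
by rewrite /potential addr_gt0// mulr_gt0 ?expR_gt0 ?invr_gt0 ?exprn_gt0.
Qed.

(** Averaging over the move multiplies [2 ^+ X] by [1 + p] and [2 ^- X] by [1 - p / 2]. The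
    inequality [1 + t <= expR t] at [t = p] and [t = - p / 2] absorbs both factors. *)
Lemma potential_supermartingale P X p :
  (1 - p) * potential (P + p) X + p * potential (P + p) X.+1 <= potential P X.
Proof.
have step (c t : R) : 0 <= c -> c * expR t * (1 - t) <= c.
  move=> c0; rewrite -mulrA ler_piMr//.
  rewrite -(@ler_pM2l _ (expR (- t))) ?expR_gt0// mulrA -expRD addNr expR0.
  by rewrite mul1r mulr1 expR_ge1Dx.
have c1 : 0 <= 2 ^+ X * expR (- P) :> R by rewrite mulr_ge0 ?exprn_ge0 ?expR_ge0.
have c2 : 0 <= 2 ^- X * expR (P / 2) :> R.
  by rewrite mulr_ge0 ?invr_ge0 ?exprn_ge0 ?expR_ge0.
have := lerD (step _ (- p) c1) (step _ (p / 2) c2).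
rewrite /potential opprD (mulrDl P) !expRD exprS invfM.
apply: le_trans; rewrite le_eqVlt; apply/orP; left; apply/eqP.
by field; rewrite expf_neq0.
Qed.

Lemma potential_bound C P X : potential P X <= C ->
  2 ^+ X <= C * expR P /\ expR (P / 2) <= C * 2 ^+ X.
Proof.
have a0 : 0 <= 2 ^+ X * expR (- P) :> R by rewrite mulr_ge0 ?exprn_ge0 ?expR_ge0.
have b0 : 0 <= 2 ^- X * expR (P / 2) :> R.
  by rewrite mulr_ge0 ?invr_ge0 ?exprn_ge0 ?expR_ge0.
rewrite /potential => LC; split.
  rewrite -ler_pdivrMr ?expR_gt0// -expRN; lra.
rewrite -ler_pdivrMr ?exprn_gt0// mulrC; lra.
Qed.

Lemma potential_bounded_equiv C N (P : nat -> R) (X : nat -> nat) :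
  {homo P : m n / (m <= n)%N >-> m <= n} ->
  {homo X : m n / (m <= n)%N} ->
  (forall n, (N <= n)%N -> potential (P n) (X n) <= C) ->
  (exists B, forall n, P n <= B) <-> (exists B, forall n, (X n)%:R <= B :> R).
Proof.
move=> Pmono Xmono LC.
have C0 : 0 <= C by apply: le_trans (LC N (leqnn N)); apply/ltW/potential_gt0.
(* Indices below [N] are handled by moving up to [maxn n N], by monotonicity. *)
have LCmax n := potential_bound (LC _ (leq_maxr n N)).
split=> -[B bnd].
  exists (C * expR B) => n.
  apply: (@le_trans _ _ (2 ^+ X (maxn n N))).
    rewrite -natrX ler_nat (leq_trans (Xmono _ _ (leq_maxl n N)))//.
    by rewrite ltnW// ltn_expl.
  by apply: le_trans (LCmax n).1 _; rewrite ler_wpM2l// ler_expR.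
have B0 : 0 <= B by apply: le_trans (bnd 0).
(* From [P / 2 <= expR (P / 2) <= C * 2 ^+ X], with [X] below the natural number [Num.bound B]. *)
exists (2 * (C * 2 ^+ Num.bound B)) => n.
apply: le_trans (Pmono _ _ (leq_maxl n N)) _.
rewrite -ler_pdivrMl// mulrC.
apply: le_trans (_ : C * 2 ^+ X (maxn n N) <= _).
  apply: le_trans (LCmax n).2.
  by have := expR_ge1Dx (P (maxn n N) / 2); lra.
rewrite ler_wpM2l// ler_eXn2l ?ltr1n//.
by rewrite -(ler_nat R) (le_trans (bnd _))// ltW// archi_boundP.
Qed.

End Potential.

Section Strategy.
Variable R : realType.
Implicit Types (h : seq (game_round R)) (p : {i01 R}) (M : R) (x : bool).

Definition forecast_sum h : R := \sum_(r <- h) r.1.1%:num.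

Definition ones h : nat := \sum_(r <- h) r.2.

Definition loss h : R := - \sum_(r <- h) r.1.2 * (r.2%:R - r.1.1%:num).

Definition history_potential h := potential (forecast_sum h) (ones h).

(* The second clause matters only while Skeptic's loss is still zero, when the
   first one is vacuous for the potential. *)
Definition good_move h p M x : Prop :=
  let h' := rcons h (p, M, x) in
  loss h * history_potential h' <= loss h' * history_potential h /\
  (loss h' = 0 -> history_potential h' <= history_potential h).

Definition compliant_strategy : reality_strategy R :=
  fun h p M => `[< good_move h p M true >].

Lemma loss_rcons h p M x :
  loss (rcons h (p, M, x)) = loss h - M * (x%:R - p%:num).
Proof. by rewrite /loss big_rcons/= opprD addrC. Qed.

Lemma good_move_exists h p M :
  0 <= loss h -> good_move h p M true \/ good_move h p M false.
Proof.
move=> D0; set L := history_potential h.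
have L0 : 0 < L by exact: potential_gt0.
pose L' x := history_potential (rcons h (p, M, x)).
have L'0 x : 0 < L' x by exact: potential_gt0.
have p0 : 0 <= p%:num by [].
have p1 : p%:num <= 1 by [].
have avg : (1 - p%:num) * L' false + p%:num * L' true <= L.
  rewrite /L' /L /history_potential /forecast_sum /ones !big_rcons/= addn0 addn1.
  exact: potential_supermartingale.
rewrite /good_move -/L -/(L' true) -/(L' false) !loss_rcons /= sub0r mulrN opprK.
move: (p%:num : R) p0 p1 (loss h) D0 (L' true) (L'0 true) (L' false) avg.
move=> q q0 q1 D + Lt Lt0 Lf avg.
rewrite le_eqVlt => /predU1P[<-|D0].
  (* With zero loss, Reality moves against Skeptic's bet. If the loss stays zero although [M] is
     nonzero, this move had probability 1, so [avg] bounds its potential by [L]. If [M = 0], [avg]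
     gives a move that does not raise the potential. *)
  rewrite !mul0r !add0r; have [M0|M0|->] := ltgtP M 0.
  - left; split; first by apply: mulr_ge0; nra.
    move=> /eqP; rewrite oppr_eq0 mulf_eq0 lt_eqF//= subr_eq0 => /eqP q1E.
    by move: avg; rewrite -q1E; lra.
  - right; split; first by apply: mulr_ge0; nra.
    move=> /eqP; rewrite mulf_eq0 gt_eqF//= => /eqP q0E.
    by move: avg; rewrite q0E; lra.
  rewrite !mul0r oppr0 mul0r; case: (leP Lt L) => [|LLt]; first by left.
  right; split=> // _; rewrite -(@ler_pM2l _ (1 - q)); last first.
    rewrite subr_gt0 lt_neqAle q1 andbT; apply/eqP => q1E.
    by move: avg; rewrite q1E; lra.
  have := ler_wpM2l q0 (ltW LLt); lra.
(* If 1 lowers the ratio of loss to potential, weighing this failure by [q] against [D] times [avg]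
   shows that 0 does not. A new loss of zero would make the new potential at most 0, hence at most
   [L]. *)
case: (leP (D * Lt) ((D - M * (1 - q)) * L)) => [DLt|DLt].
  left; split=> // E; move: DLt; rewrite E mul0r; nra.
right; have DLf : D * Lf <= (D + M * q) * L.
  have q1' : q < 1.
    rewrite lt_neqAle q1 andbT; apply/eqP => q1E; move: avg DLt; rewrite q1E; nra.
  rewrite -(@ler_pM2l _ (1 - q)) ?subr_gt0//.
  have := ler_wpM2l (ltW D0) avg; have := ler_wpM2l q0 (ltW DLt); lra.
split=> // E; move: DLf; rewrite E mul0r; nra.
Qed.

Lemma compliant_strategyP h p M :
  0 <= loss h -> good_move h p M (compliant_strategy h p M).
Proof.
move=> D0; rewrite /compliant_strategy; case: asboolP => // not_good.
by case: (good_move_exists p M D0).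
Qed.

Section Play.
Variables (p : nat -> {i01 R}) (M : nat -> R).
Let h := history compliant_strategy p M.
Let x := outcome compliant_strategy p M.

Lemma forecast_sum_history n : forecast_sum (h n) = \sum_(0 <= i < n) (p i)%:num.
Proof.
rewrite /forecast_sum; elim: n => [|n IH]; first by rewrite big_nil big_geq.
by rewrite /h/= big_rcons/= IH big_nat_recr//= addrC.
Qed.

Lemma ones_history n : ones (h n) = (\sum_(0 <= i < n) x i)%N.
Proof.
rewrite /ones; elim: n => [|n IH]; first by rewrite big_nil big_geq.
by rewrite /h/= big_rcons/= IH big_nat_recr//= addnC.
Qed.

Lemma capital_history n : capital p M x n = 1 - loss (h n).
Proof.
elim: n => [|n IH]; first by rewrite /loss big_nil oppr0 subr0.
by rewrite /h/= loss_rcons IH /x /outcome; ring.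
Qed.

Lemma loss_history_ge0 n : 0 <= loss (h n).
Proof.
elim: n => [|n IH]; first by rewrite /loss big_nil oppr0.
have [+ _] := compliant_strategyP (p n) (M n) IH.
move=> /(le_trans _) le_loss.
rewrite -(@pmulr_lge0 _ (history_potential (h n))) ?potential_gt0//.
by apply: le_loss; rewrite mulr_ge0// ltW// potential_gt0.
Qed.

Lemma history_move n : good_move (h n) (p n) (M n) (x n).
Proof. exact/compliant_strategyP/loss_history_ge0. Qed.

Lemma history_potential_bounded : (forall n, 0 <= capital p M x n) ->
  exists C N, forall n, (N <= n)%N -> history_potential (h n) <= C.
Proof.
move=> K0.
have [[N DN]|D0] := pselect (exists N, 0 < loss (h N)); last first.
  exists (history_potential (h 0)), 0%N => n _.
  elim: n => [//|n]; apply: le_trans; apply: (history_move n).2.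
  apply/eqP; apply: contra_notT D0 => Dn; exists n.+1.
  by rewrite lt_neqAle eq_sym Dn; exact: loss_history_ge0.
(* The ratio of loss to potential is at least its value at [N], while nonnegative capital keeps the
   loss at most 1. *)
exists (history_potential (h N) / loss (h N)), N => n Nn.
have ratio : loss (h N) * history_potential (h n) <=
             loss (h n) * history_potential (h N).
  elim: n Nn => [|n IH]; first by rewrite leqn0 => /eqP ->.
  rewrite leq_eqVlt => /predU1P[->//|/IH {}IH].
  have [step _] := history_move n.
  have L0 k : 0 < history_potential (h k) by exact: potential_gt0.
  (* Transitivity of the ratio comparison in cross-multiplied form: the potential at [n] is the
     common denominator. *)
  rewrite -(ler_pM2r (L0 n)).
  have := ler_wpM2r (ltW (L0 n.+1)) IH; have := ler_wpM2r (ltW (L0 N)) step.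
  rewrite -/(h n.+1); lra.
rewrite ler_pdivlMr// mulrC (le_trans ratio)// ler_piMl//.
  exact/ltW/potential_gt0.
by have := K0 n; rewrite capital_history subr_ge0.
Qed.

End Play.
End Strategy.

Theorem theorem3p4 (R : realType) :
  can_strongly_comply
    [set xi : game_path R |
      (\sum_(0 <= n <oo) ((xi n).1%:num)%:E < +oo)%E <->
      (\sum_(0 <= n <oo) ((xi n).2%:R : R)%:E < +oo)%E].
Proof.
exists (@compliant_strategy R) => p M /= K0; split; last first.
  by move=> n; rewrite capital_history gerBl loss_history_ge0.
have [C [N LC]] := history_potential_bounded K0.
rewrite !nneseries_lty_bounded//=.
set x := outcome _ p M in K0 LC *.
(* The count of ones must be a natural number, being an exponent in the potential. *)
under [X in _ <-> X]eq_exists do under eq_forall do rewrite -natr_sum.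
apply: (@potential_bounded_equiv R C N (fun n => \sum_(0 <= i < n) (p i)%:num)
  (fun n => \sum_(0 <= i < n) x i)%N).
- apply: homo_leq => //; first exact: le_trans.
  by move=> n; rewrite big_nat_recr//= lerDl.
- apply: homo_leq => //; first exact: leq_trans.
  by move=> n; rewrite big_nat_recr//= leq_addr.
- by move=> n Nn; rewrite -(forecast_sum_history p M) -ones_history; exact: LC.
Qed.
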